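(* The set of null triples is a $\mathrm{G}_2'$-torsor: given two null triples $(x,y,z)$ and $(x',y',z')$ in $\mathbb{I}$, there exists a unique element $g\in\mathrm{G}_2'$ such that $(gx,gy,gz)=(x',y',z')$.
   Context: $\mathbb{H}$ denotes the quaternions. The split octonions $\mathbb{O}'$ are the real vector space $\mathbb{H}\oplus\mathbb{H}$ with product $(a,b)(c,d)=(ac+d\overline{b},\,\overline{a}d+cb)$, conjugation $\overline{(a,b)}=(\overline{a},-b)$ and quadratic form $Q(a,b)=|a|^2-|b|^2$. The imaginary split octonions are $\mathbb{I}=\{x\in\mathbb{O}':\overline{x}=-x\}=\mathrm{Im}(\mathbb{H})\oplus\mathbb{H}$. The dot product is the symmetric bilinear form with $x\cdot x=Q(x)$; the cross product on $\mathbb{I}$ is $x\times y=\tfrac12(xy-yx)$. A vector $x$ is null if $x\cdot x=0$. $\mathrm{G}_2'$ is the group of algebra automorphisms of $\mathbb{O}'$; it preserves $\mathbb{I}$. A null triple is an ordered triple $(x,y,z)$ of nonzero null vectors in $\mathbb{I}$ that are pairwise orthogonal and satisfy $(x\times y)\cdot z=\tfrac12$. *)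

(* Defs.v *)
From HB Require Import structures.
From mathcomp Require Import all_boot all_order all_algebra.
From mathcomp Require Import boolp classical_sets reals.
From mathcomp Require Import ring.

Set Implicit Arguments.
Unset Strict Implicit.
Unset Printing Implicit Defensive.

Import Order.TTheory GRing.Theory Num.Theory.
Local Open Scope classical_set_scope.
Local Open Scope ring_scope.

(* Quat a b c d stands for a + b i + c j + d k. *)
Record quaternion (R : realType) : Type :=
  Quat { q_re : R; q_i : R; q_j : R; q_k : R }.

Section QuaternionAlgebra.
Variable R : realType.
Local Notation H := (quaternion R).

Definition quat_to_tuple (a : H) : R * R * R * R :=
  (q_re a, q_i a, q_j a, q_k a).
Definition quat_of_tuple (t : R * R * R * R) : H :=
  Quat t.1.1.1 t.1.1.2 t.1.2 t.2.
Lemma quat_to_tupleK : cancel quat_to_tuple quat_of_tuple.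
Proof. by case. Qed.

HB.instance Definition _ := Choice.copy H (can_type quat_to_tupleK).

Definition quat_add (a b : H) : H :=
  Quat (q_re a + q_re b) (q_i a + q_i b) (q_j a + q_j b) (q_k a + q_k b).
Definition quat_opp (a : H) : H :=
  Quat (- q_re a) (- q_i a) (- q_j a) (- q_k a).
Definition quat_scale (r : R) (a : H) : H :=
  Quat (r * q_re a) (r * q_i a) (r * q_j a) (r * q_k a).
Definition quat_mul (a b : H) : H :=
  Quat (q_re a * q_re b - q_i a * q_i b - q_j a * q_j b - q_k a * q_k b)
       (q_re a * q_i b + q_i a * q_re b + q_j a * q_k b - q_k a * q_j b)
       (q_re a * q_j b - q_i a * q_k b + q_j a * q_re b + q_k a * q_i b)
       (q_re a * q_k b + q_i a * q_j b - q_j a * q_i b + q_k a * q_re b).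

Lemma quat_addA : associative quat_add.
Proof. by move=> a b c; congr Quat; exact: addrA. Qed.
Lemma quat_addC : commutative quat_add.
Proof. by move=> a b; congr Quat; exact: addrC. Qed.
Lemma quat_add0 : left_id (Quat 0 0 0 0) quat_add.
Proof. by case=> *; congr Quat; exact: add0r. Qed.
Lemma quat_addN : left_inverse (Quat 0 0 0 0) quat_opp quat_add.
Proof. by move=> a; congr Quat; exact: addNr. Qed.

HB.instance Definition _ :=
  GRing.isZmodule.Build H quat_addA quat_addC quat_add0 quat_addN.

Lemma quat_mulA : associative quat_mul.
Proof. by move=> [????] [????] [????]; congr Quat => /=; ring. Qed.
Lemma quat_mul1q : left_id (Quat 1 0 0 0) quat_mul.
Proof. by case=> *; congr Quat => /=; ring. Qed.
Lemma quat_mulq1 : right_id (Quat 1 0 0 0) quat_mul.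
Proof. by case=> *; congr Quat => /=; ring. Qed.
Lemma quat_mulDl : left_distributive quat_mul +%R.
Proof. by move=> [????] [????] [????]; congr Quat => /=; ring. Qed.
Lemma quat_mulDr : right_distributive quat_mul +%R.
Proof. by move=> [????] [????] [????]; congr Quat => /=; ring. Qed.
Lemma quat_1_neq0 : Quat 1 0 0 0 != 0 :> H.
Proof. by apply/eqP => -[] /eqP; rewrite oner_eq0. Qed.

HB.instance Definition _ := GRing.Zmodule_isNzRing.Build H
  quat_mulA quat_mul1q quat_mulq1 quat_mulDl quat_mulDr quat_1_neq0.

Lemma quat_scaleA (r s : R) (a : H) :
  quat_scale r (quat_scale s a) = quat_scale (r * s) a.
Proof. by congr Quat; exact: mulrA. Qed.
Lemma quat_scale1 : left_id 1 quat_scale.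
Proof. by case=> *; congr Quat; exact: mul1r. Qed.
Lemma quat_scaleDr : right_distributive quat_scale +%R.
Proof. by move=> r a b; congr Quat; exact: mulrDr. Qed.
Lemma quat_scaleDl (a : H) : {morph quat_scale^~ a : r s / r + s}.
Proof. by move=> r s; congr Quat; exact: mulrDl. Qed.

HB.instance Definition _ := GRing.Zmodule_isLmodule.Build R H
  quat_scaleA quat_scale1 quat_scaleDr quat_scaleDl.

Definition quat_conj (a : H) : H :=
  Quat (q_re a) (- q_i a) (- q_j a) (- q_k a).

(* |a|^2 *)
Definition quat_normsq (a : H) : R :=
  q_re a ^+ 2 + q_i a ^+ 2 + q_j a ^+ 2 + q_k a ^+ 2.

Lemma quat_mul_conj (a : H) : a * quat_conj a = quat_normsq a *: (1 : H).
Proof. by case: a => *; congr Quat => /=; rewrite /quat_normsq /=; ring. Qed.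

End QuaternionAlgebra.

(* Only the real vector space structure of the direct sum H (+) H is used: the
   product of split octonions is oct_mul, not the componentwise ring product
   that *%R denotes on pairs. *)
Definition split_octonion (R : realType) : Type :=
  (quaternion R * quaternion R)%type.

Section SplitOctonions.
Variable R : realType.
Local Notation O' := (split_octonion R).

Definition oct_mul (x y : O') : O' :=
  let: (a, b) := x in let: (c, d) := y in
  (a * c + d * quat_conj b, quat_conj a * d + c * b).

Definition oct_conj (x : O') : O' := (quat_conj x.1, - x.2).

Definition oct_Q (x : O') : R := quat_normsq x.1 - quat_normsq x.2.

(* The symmetric bilinear form polarizing Q; see oct_dotxx, oct_dotC and
   oct_dot_linear. *)
Definition oct_dot (x y : O') : R := (oct_Q (x + y) - oct_Q x - oct_Q y) / 2.

Definition imag_octonion : set O' := [set x | oct_conj x = - x].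

(* The cross product of the imaginary split octonions, extended by the same
   formula to all of O'. *)
Definition oct_cross (x y : O') : O' :=
  2^-1 *: (oct_mul x y - oct_mul y x).

Definition null_vector (x : O') : Prop := oct_dot x x = 0.

Definition null_triple (t : O' * O' * O') : Prop :=
  let: (x, y, z) := t in
  [/\ [/\ imag_octonion x, imag_octonion y & imag_octonion z],
      [/\ x <> 0, y <> 0 & z <> 0],
      [/\ null_vector x, null_vector y & null_vector z],
      [/\ oct_dot x y = 0, oct_dot y z = 0 & oct_dot x z = 0]
    & oct_dot (oct_cross x y) z = 2^-1].

(* A multiplicative bijection fixes the unit element, so that condition is not
   listed separately. *)
Definition G2' : set (O' -> O') :=
  [set g | [/\ linear g, bijective g
             & forall x y, g (oct_mul x y) = oct_mul (g x) (g y)]].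

Definition act_triple (g : O' -> O') (t : O' * O' * O') : O' * O' * O' :=
  (g t.1.1, g t.1.2, g t.2).

Lemma oct_dotxx x : oct_dot x x = oct_Q x.
Proof.
case: x => [[????] [????]].
by rewrite /oct_dot /oct_Q /quat_normsq /=; field.
Qed.

Lemma oct_dotC x y : oct_dot x y = oct_dot y x.
Proof. by rewrite /oct_dot (addrC x) addrAC. Qed.

Lemma oct_dot_linear r x y z :
  oct_dot (r *: x + y) z = r * oct_dot x z + oct_dot y z.
Proof.
case: x y z => [[????] [????]] [[????] [????]] [[????] [????]].
by rewrite /oct_dot /oct_Q /quat_normsq /=; field.
Qed.

Lemma imag_octonionP (x : O') : imag_octonion x <-> q_re x.1 = 0.
Proof.
case: x => [[a b c d] [e f g h]]; split=> /=; last by move=> ->; rewrite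
  /imag_octonion /= /oct_conj /=; congr (_, _); congr Quat; rewrite oppr0.
by move=> [] /eqP; rewrite -addr_eq0 -mulr2n mulrn_eq0 /= => /eqP.
Qed.

Lemma G2'_id : G2' id.
Proof. by split=> //; exists id. Qed.

Lemma G2'_comp g h : G2' g -> G2' h -> G2' (g \o h).
Proof.
move=> [gl gb gm] [hl hb hm]; split; last by move=> x y /=; rewrite hm gm.
  by move=> r x y /=; rewrite hl gl.
exact: bij_comp.
Qed.

Lemma G2'_inv g h : G2' g -> cancel g h -> cancel h g -> G2' h.
Proof.
move=> [gl _ gm] gK hK; split.
- by move=> r x y; apply: (can_inj gK); rewrite gl !hK.
- by exists g.
- by move=> x y; apply: (can_inj gK); rewrite gm !hK.
Qed.

End SplitOctonions.

Arguments G2' R : clear implicits.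
Arguments imag_octonion R : clear implicits.

(* Main.v *)
From HB Require Import structures.
Require Import Defs.
From mathcomp Require Import all_boot all_order all_algebra.
From mathcomp Require Import boolp classical_sets reals.
From mathcomp Require Import ring.

(** A null triple [(x, y, z)] generates the split octonions in a way that does
not depend on the triple.  Vectors of [I] satisfy [u v + v u = - 2 (u . v) 1],
so [x], [y], [z] square to zero and anticommute, and the last condition says
that [p = - x (y z)] and [q = - (y z) x] add up to [1].  From these relations
the alternative and Moufang laws yield the products of any two of the eight
elements [p, x, y, z, q, y z, z x, x y] ([zorn_generators_table]): they
multiply like the matrix units of Zorn's algebra of vector matrices
[[a, v; w, b]], whatever the triple is.

Hence every null triple [t] gives a linear multiplicative map [zorn_map t] from
Zorn's algebra to the split octonions.  It carries the norm
[a b + v . w] of vector matrices to [Q] ([zorn_map_norm]); since this norm is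
nondegenerate the map is injective, and since both sides have dimension 8 it is
bijective.  For two null triples [t] and [t'], the map
[zorn_map t' o (zorn_map t)^-1] is therefore an automorphism carrying [t] to
[t'].  It is the only one because [zorn_map t] is built from [t] by the
algebra operations, so that [g o zorn_map t = zorn_map (g t)] for every
automorphism [g] ([zorn_map_act]).

The action is well defined because automorphisms commute with conjugation
([G2'_conj]): real part and norm of [u] are the coefficients of the quadratic
equation that [u] satisfies.  They therefore preserve [Q] and the dot
product. *)

Set Implicit Arguments.
Unset Strict Implicit.
Unset Printing Implicit Defensive.

Import GRing.Theory Num.Theory.
Local Open Scope ring_scope.

Local Notation "x ** y" := (oct_mul x y) (at level 40, left associativity).

Definition oct_one (R : realType) : split_octonion R := (1, 0).
Local Notation "1o" := (oct_one _).

(** * Linear maps *)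

(** For maps such as automorphisms, which are given with a proof of linearity
instead of a structure. *)
Lemma linear_morphisms (K : pzRingType) (U V : lmodType K) (f : U -> V) :
  linear f ->
  [/\ f 0 = 0, {morph f : u / - u}, {morph f : u v / u + v} & scalable f].
Proof.
move=> f_lin; pose f_mixin := GRing.isLinear.Build K U V *:%R f f_lin.
pose F : {linear U -> V} := HB.pack f f_mixin.
split; [exact: (raddf0 F) | exact: (raddfN F) | exact: (raddfD F) |].
by move=> r u; exact: (linearZ_LR F).
Qed.

Lemma linear_inj_bij (K : fieldType) (V : vectType K) (f : V -> V) :
  linear f -> injective f -> bijective f.
Proof.
move=> f_lin f_inj; pose f_mixin := GRing.isLinear.Build K V V *:%R f f_lin.
pose F : {linear V -> V} := HB.pack f f_mixin.
have kerF : lker (linfun F) == 0%VS.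
  by apply/lker0P => u v; rewrite !lfunE; apply: f_inj.
exists ((linfun F)^-1)%VF => v.
  by have := lker0_lfunK kerF v; rewrite lfunE.
by have := lker0_lfunVK kerF v; rewrite lfunE.
Qed.

Definition quat_row (R : realType) (a : quaternion R) : 'rV[R]_4 :=
  \row_i [:: q_re a; q_i a; q_j a; q_k a]`_i.

(** Through the product of vector spaces this makes pairs of quaternions an
8-dimensional space, to which [linear_inj_bij] applies. *)
Lemma quat_vect_axiom (R : realType) : Vector.axiom 4 (quaternion R).
Proof.
exists (@quat_row R).
  move=> r [????] [????]; apply/rowP => i.
  by rewrite !mxE; case: i => [[|[|[|[|]]]]].
exists (fun v : 'rV[R]_4 => Quat (v 0 0) (v 0 1) (v 0 2) (v 0 3)).
  by case=> ????; rewrite /quat_row !mxE.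
move=> v; apply/rowP => i; rewrite mxE.
by case: i => [[|[|[|[|]]]]] //= lti; congr (v _ _); apply: val_inj.
Qed.

HB.instance Definition _ (R : realType) :=
  Lmodule_hasFinDim.Build R (quaternion R) (@quat_vect_axiom R).

(** * The algebra of split octonions *)

(** Reduces an equation between split octonions to eight equations between real
polynomials in the coordinates. *)
Ltac oct_coords :=
  repeat match goal with
    x : split_octonion _ |- _ => case: x => [[????] [????]] end;
  congr (Quat _ _ _ _, Quat _ _ _ _); rewrite /quat_normsq /=.

Section OctonionAlgebra.
Variable R : realType.
Local Notation O' := (split_octonion R).
Implicit Types x y z : O'.

Lemma oct_mulDl x y z : (x + y) ** z = x ** z + y ** z.
Proof. by oct_coords; ring. Qed.
Lemma oct_mulDr x y z : x ** (y + z) = x ** y + x ** z.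
Proof. by oct_coords; ring. Qed.
Lemma oct_mulZl r x y : (r *: x) ** y = r *: (x ** y).
Proof. by oct_coords; ring. Qed.
Lemma oct_mulZr r x y : x ** (r *: y) = r *: (x ** y).
Proof. by oct_coords; ring. Qed.
Lemma oct_mulNl x y : (- x) ** y = - (x ** y).
Proof. by rewrite -scaleN1r oct_mulZl scaleN1r. Qed.
Lemma oct_mulNr x y : x ** (- y) = - (x ** y).
Proof. by rewrite -[- y]scaleN1r oct_mulZr scaleN1r. Qed.
Lemma oct_mul0 x : x ** 0 = 0.
Proof. by rewrite -(scale0r x) oct_mulZr !scale0r. Qed.
Lemma oct_0mul x : 0 ** x = 0.
Proof. by rewrite -(scale0r x) oct_mulZl !scale0r. Qed.
Lemma oct_mul1 x : x ** 1o = x.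
Proof. by oct_coords; ring. Qed.
Lemma oct_1mul x : 1o ** x = x.
Proof. by oct_coords; ring. Qed.

Lemma oct_mul_altl x y : x ** (x ** y) = (x ** x) ** y.
Proof. by oct_coords; ring. Qed.
Lemma oct_mul_altr x y : (y ** x) ** x = y ** (x ** x).
Proof. by oct_coords; ring. Qed.
Lemma oct_moufang x y z : (x ** y) ** (z ** x) = (x ** (y ** z)) ** x.
Proof. by oct_coords; ring. Qed.
(** Polarized alternative laws: anticommuting factors can be moved across each
other. *)
Lemma oct_mul_altl2 x y z :
  x ** (y ** z) + y ** (x ** z) = (x ** y + y ** x) ** z.
Proof. by oct_coords; ring. Qed.
Lemma oct_mul_altr2 x y z :
  (z ** x) ** y + (z ** y) ** x = z ** (x ** y + y ** x).
Proof. by oct_coords; ring. Qed.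

Lemma oct_conjM x y : oct_conj (x ** y) = oct_conj y ** oct_conj x.
Proof. by oct_coords; ring. Qed.
Lemma oct_conjN x : oct_conj (- x) = - oct_conj x.
Proof. by oct_coords; ring. Qed.
Lemma oct_conj_linear : linear (@oct_conj R).
Proof. by move=> r x y; oct_coords; ring. Qed.
Lemma oct_mul_conj x : x ** oct_conj x = oct_Q x *: 1o.
Proof. by rewrite /oct_Q; oct_coords; ring. Qed.
Lemma oct_add_conj x : x + oct_conj x = (q_re x.1 *+ 2) *: 1o.
Proof. by oct_coords; ring. Qed.
Lemma oct_mul_conj_polar x y :
  x ** oct_conj y + y ** oct_conj x = (2 * oct_dot x y) *: 1o.
Proof. by rewrite /oct_dot /oct_Q; oct_coords; field. Qed.
Lemma oct_one_scale_inj (r s : R) : r *: (1o : O') = s *: 1o -> r = s.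
Proof. by move=> [/=]; rewrite !mulr1. Qed.

(** For [x] not real this equation determines the real part and the norm of [x]
in terms of the product and the unit alone. *)
Lemma oct_sqr x : x ** x = (q_re x.1 *+ 2) *: x - oct_Q x *: 1o.
Proof.
have -> : (q_re x.1 *+ 2) *: x = x ** (x + oct_conj x).
  by rewrite oct_add_conj oct_mulZr oct_mul1.
by rewrite -oct_mul_conj oct_mulDr addrK.
Qed.

Lemma oct_conjE x : oct_conj x = (q_re x.1 *+ 2) *: 1o - x.
Proof. by rewrite -oct_add_conj addrC addrA addNr add0r. Qed.

End OctonionAlgebra.

(** * Automorphisms preserve the quadratic form *)

Section Automorphisms.
Variable R : realType.
Local Notation O' := (split_octonion R).
Implicit Types (x y z : O') (g : O' -> O') (t : O' * O' * O').

Lemma G2'_one g : G2' R g -> g 1o = 1o.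
Proof.
move=> [_ [h _ gK] gM].
by rewrite -[g 1o]oct_1mul -{1}[1o]gK -gM oct_mul1 gK.
Qed.

(** If [x] is imaginary then [x x] is real, hence so is [g x g x].  The quadratic
equation of [g x] then makes [2 re (g x) g x] real.  If the real part of [g x]
were not zero, [g x] and with it [x] would be real multiples of [1], so [x]
and [g x] would be zero. *)
Lemma G2'_imag g x : G2' R g -> q_re x.1 = 0 -> q_re (g x).1 = 0.
Proof.
move=> gG x0; have g1 := G2'_one gG.
have [/linear_morphisms[_ gN _ gZ] [h hK _] gM] := gG.
have sq := oct_sqr (g x).
have := oct_sqr x; rewrite x0 mul0rn scale0r sub0r => /(congr1 g).
rewrite gM sq gN gZ g1 => /eqP.
rewrite subr_eq addrC -scaleNr -scalerDl => /eqP re_gx.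
apply/eqP/negPn/negP => re0.
have re2 : q_re (g x).1 *+ 2 != 0 by rewrite mulrn_eq0.
move: re_gx => /(congr1 (fun u : O' => (q_re (g x).1 *+ 2)^-1 *: u)).
rewrite !scalerA mulVf // scale1r; set r := _^-1 * _ => gxE.
have xE : x = r *: 1o by apply: (can_inj hK); rewrite gxE gZ g1.
have r0 : r = 0 by move: x0; rewrite xE /= mulr1.
by move: re0; rewrite gxE r0 /= mul0r eqxx.
Qed.

Lemma G2'_re g x : G2' R g -> q_re (g x).1 = q_re x.1.
Proof.
move=> gG; have g1 := G2'_one gG; have [/linear_morphisms[_ _ gD gZ] _ _] := gG.
have -> : x = q_re x.1 *: 1o + (x - q_re x.1 *: 1o) by rewrite addrC subrK.
set v := x - _; have v0 : q_re v.1 = 0 by rewrite /v /=; ring.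
by rewrite gD gZ g1 /= (G2'_imag gG v0); ring.
Qed.

Lemma G2'_conj g x : G2' R g -> g (oct_conj x) = oct_conj (g x).
Proof.
move=> gG; have g1 := G2'_one gG; have [/linear_morphisms[_ gN gD gZ] _ _] := gG.
by rewrite !oct_conjE (G2'_re _ gG) gD gN gZ g1.
Qed.

Lemma G2'_Q g x : G2' R g -> oct_Q (g x) = oct_Q x.
Proof.
move=> gG; have g1 := G2'_one gG; have [/linear_morphisms[_ _ _ gZ] _ gM] := gG.
apply: oct_one_scale_inj.
by rewrite -oct_mul_conj -G2'_conj // -gM oct_mul_conj gZ g1.
Qed.

Lemma G2'_dot g x y : G2' R g -> oct_dot (g x) (g y) = oct_dot x y.
Proof.
move=> gG; have [/linear_morphisms[_ _ gD _] _ _] := gG.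
by rewrite /oct_dot -gD !(G2'_Q _ gG).
Qed.

Lemma null_triple_act g t :
  G2' R g -> null_triple t -> null_triple (act_triple g t).
Proof.
case: t => [[x y] z] gG [[xI yI zI] [x0 y0 z0] [xN yN zN] [xy yz xz] xyz].
have [/linear_morphisms[g0 gN gD gZ] [h hK _] gM] := gG.
have imag u : imag_octonion R u -> imag_octonion R (g u).
  by move=> uI; rewrite /imag_octonion /= -G2'_conj // uI gN.
have neq0 u : u <> 0 -> g u <> 0.
  by move=> u0 gu0; apply: u0; apply: (can_inj hK); rewrite gu0 g0.
split; [split; exact: imag | split; exact: neq0 | | |].
- by rewrite /null_vector !G2'_dot.
- by rewrite !G2'_dot.
by rewrite /oct_cross -!gM -gN -gD -gZ G2'_dot.
Qed.

End Automorphisms.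

(** * The multiplication table of a null triple *)

Section Relations.
Variable R : realType.
Local Notation O' := (split_octonion R).
Implicit Types x y z : O'.

(** What remains of the notion of null triple once the dot product is eliminated
in favour of the octonion product.  These relations are invariant under cyclic
rotation, and the whole multiplication table follows from them. *)
Definition zorn_generators x y z : Prop :=
  [/\ [/\ oct_conj x = - x, oct_conj y = - y & oct_conj z = - z],
      [/\ x ** x = 0, y ** y = 0 & z ** z = 0],
      [/\ y ** x = - (x ** y), z ** y = - (y ** z) & x ** z = - (z ** x)]
    & x ** (y ** z) + (y ** z) ** x = - 1o].

Lemma imag_anticomm x y :
  oct_conj x = - x -> oct_conj y = - y ->
  x ** y + y ** x = - ((2 * oct_dot x y) *: 1o).
Proof.
move=> xI yI; rewrite -oct_mul_conj_polar xI yI !oct_mulNr.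
by rewrite -opprD opprK.
Qed.

(** Although the product is not associative, a product of three anticommuting
elements, bracketed on one fixed side, is invariant under rotation. *)
Lemma oct_mul_rotl x y z :
  y ** x = - (x ** y) -> x ** z = - (z ** x) ->
  x ** (y ** z) = y ** (z ** x).
Proof.
move=> yx xz; have := oct_mul_altl2 x y z.
by rewrite yx subrr oct_0mul xz oct_mulNr => /subr0_eq.
Qed.

Lemma oct_mul_rotr x y z :
  z ** y = - (y ** z) -> x ** z = - (z ** x) ->
  (x ** y) ** z = (z ** x) ** y.
Proof.
move=> zy xz; have := oct_mul_altr2 y z x.
by rewrite zy subrr oct_mul0 xz oct_mulNl => /subr0_eq.
Qed.

Lemma zorn_generators_rot x y z :
  zorn_generators x y z -> zorn_generators y z x.
Proof.
move=> [[xI yI zI] [xx yy zz] [yx zy xz] xyz].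
split; [by split|by split|by split|].
by rewrite -(oct_mul_rotl yx xz) -(oct_mul_rotr zy xz) -(oct_mul_rotr xz yx).
Qed.

Lemma null_triple_generators x y z :
  null_triple (x, y, z) -> zorn_generators x y z.
Proof.
move=> [[xI yI zI] _ [xN yN zN] [xy0 yz0 xz0] xyz].
have sq u : imag_octonion R u -> null_vector u -> u ** u = 0.
  move=> uI; rewrite /null_vector oct_dotxx => uN.
  have := oct_mul_conj u; rewrite uI uN oct_mulNr scale0r.
  by move/eqP; rewrite oppr_eq0 => /eqP.
have anti u v : imag_octonion R u -> imag_octonion R v -> oct_dot u v = 0 ->
    u ** v = - (v ** u).
  move=> uI vI uv0; apply/eqP; rewrite -addr_eq0 imag_anticomm // uv0.
  by rewrite mulr0 scale0r oppr0.
have yx : y ** x = - (x ** y) by rewrite [x ** y]anti // opprK.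
have zy : z ** y = - (y ** z) by rewrite [y ** z]anti // opprK.
have xz : x ** z = - (z ** x) by apply: anti.
have xyI : oct_conj (x ** y) = - (x ** y).
  by rewrite oct_conjM xI yI oct_mulNr oct_mulNl opprK.
have cross : oct_cross x y = x ** y.
  rewrite /oct_cross yx opprK -mulr2n -scaler_nat scalerA.
  by rewrite mulVf ?scale1r // pnatr_eq0.
split; [by split|split; exact: sq|by split|].
rewrite (oct_mul_rotl yx xz) (oct_mul_rotl zy yx) (oct_mul_rotr xz yx).
rewrite addrC imag_anticomm // -cross xyz.
by rewrite divff ?scale1r // pnatr_eq0.
Qed.

(** Complementary idempotents, the diagonal matrix units of Zorn's algebra. *)
Definition zorn_p x y z := - (x ** (y ** z)).
Definition zorn_q x y z := - ((y ** z) ** x).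

Lemma zorn_p_rot x y z : zorn_generators x y z -> zorn_p y z x = zorn_p x y z.
Proof. by case=> _ _ [yx zy xz] _; rewrite /zorn_p -(oct_mul_rotl yx xz). Qed.

Lemma zorn_q_rot x y z : zorn_generators x y z -> zorn_q y z x = zorn_q x y z.
Proof.
case=> _ _ [yx zy xz] _.
by rewrite /zorn_q (oct_mul_rotr xz yx) -(oct_mul_rotr zy xz).
Qed.

Lemma zorn_pq1 x y z : zorn_generators x y z -> zorn_p x y z + zorn_q x y z = 1o.
Proof. by case=> _ _ _ e; rewrite /zorn_p /zorn_q -opprD e opprK. Qed.

Lemma oct_mul_compl_l u v w : u + v = 1o -> u ** w = 0 -> v ** w = w :> O'.
Proof. by move=> uv uw; rewrite -[RHS]oct_1mul -uv oct_mulDl uw add0r. Qed.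

Lemma oct_mul_compl_r u v w : u + v = 1o -> w ** u = 0 -> w ** v = w :> O'.
Proof. by move=> uv uw; rewrite -[RHS]oct_mul1 -uv oct_mulDr uw add0r. Qed.

Lemma zorn_p_mul x y z : zorn_generators x y z -> zorn_p x y z ** x = x.
Proof.
move=> gen; have [_ [xx _ _] _ _] := gen.
apply: (oct_mul_compl_l (u := zorn_q x y z)); first by rewrite addrC zorn_pq1.
by rewrite /zorn_q oct_mulNl oct_mul_altr xx oct_mul0 oppr0.
Qed.

(** One third of the products of [p, q, e1, e2, e3, f1, f2, f3]: the other ones
with a factor [ei] or [fi] arise by rotating the indices.  A product type rather
than a conjunction, so that it can be used as a rewriting rule. *)
Definition zorn_table p q e1 e2 e3 f1 f2 f3 : Type :=
  ((p ** e1 = e1 :> O') * (e1 ** p = 0 :> O') * (q ** e1 = 0 :> O') *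
   (e1 ** q = e1 :> O') * (p ** f1 = 0 :> O') * (f1 ** p = f1 :> O') *
   (q ** f1 = f1 :> O') * (f1 ** q = 0 :> O') *
   (e1 ** e1 = 0 :> O') * (e1 ** e2 = f3 :> O') * (e2 ** e1 = - f3 :> O') *
   (f1 ** f1 = 0 :> O') * (f1 ** f2 = e3 :> O') * (f2 ** f1 = - e3 :> O') *
   (e1 ** f1 = - p :> O') * (f1 ** e1 = - q :> O') *
   (e1 ** f2 = 0 :> O') * (f2 ** e1 = 0 :> O') *
   (e1 ** f3 = 0 :> O') * (f3 ** e1 = 0 :> O'))%type.

(** The alternative laws collapse every product in which one of [x], [y z] is
squared; the action of the idempotents follows because [p + q = 1].  The product
of [y z] and [z x] has the form [(z u) (v z)] up to sign, to which the Moufang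
law applies. *)
Lemma zorn_generators_table x y z :
  zorn_generators x y z ->
  zorn_table (zorn_p x y z) (zorn_q x y z) x y z (y ** z) (z ** x) (x ** y).
Proof.
move=> gen; have p1q := zorn_pq1 gen.
have [_ [xx yy zz] [yx zy xz] _] := gen.
have genz := zorn_generators_rot (zorn_generators_rot gen).
have bb : (y ** z) ** (y ** z) = 0.
  rewrite -{2}[y ** z]opprK -zy oct_mulNr oct_moufang zz.
  by rewrite oct_mul0 oct_0mul oppr0.
have xp : x ** zorn_p x y z = 0.
  by rewrite /zorn_p oct_mulNr oct_mul_altl xx oct_0mul oppr0.
have qx : zorn_q x y z ** x = 0.
  by rewrite /zorn_q oct_mulNl oct_mul_altr xx oct_mul0 oppr0.
have pb : zorn_p x y z ** (y ** z) = 0.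
  by rewrite /zorn_p oct_mulNl oct_mul_altr bb oct_mul0 oppr0.
have bq : (y ** z) ** zorn_q x y z = 0.
  by rewrite /zorn_q oct_mulNr oct_mul_altl bb oct_0mul oppr0.
have q1p : zorn_q x y z + zorn_p x y z = 1o by rewrite addrC.
have xa : x ** (x ** y) = 0 by rewrite oct_mul_altl xx oct_0mul.
have cx : (z ** x) ** x = 0 by rewrite oct_mul_altr xx oct_mul0.
have xc : x ** (z ** x) = 0.
  by rewrite -[z ** x]opprK -xz oct_mulNr oct_mul_altl xx oct_0mul oppr0.
have ax : (x ** y) ** x = 0.
  by rewrite -[x ** y]opprK -yx oct_mulNl oct_mul_altr xx oct_mul0 oppr0.
have bc : (y ** z) ** (z ** x) = z.
  rewrite -[y ** z]opprK -[z ** x]opprK -zy -xz oct_mulNl oct_mulNr opprK.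
  by rewrite oct_moufang yx oct_mulNr -/(zorn_p z x y) zorn_p_mul.
have cb : (z ** x) ** (y ** z) = - z.
  by rewrite oct_moufang -[z ** _]opprK oct_mulNl -/(zorn_p z x y) zorn_p_mul.
repeat split => //; rewrite ?opprK //.
- exact: oct_mul_compl_l q1p qx.
- exact: oct_mul_compl_r p1q xp.
- exact: oct_mul_compl_r q1p bq.
- exact: oct_mul_compl_l p1q pb.
Qed.
End Relations.

(** * Zorn's vector matrices *)

Section ZornMap.
Variable R : realType.
Local Notation O' := (split_octonion R).
Local Notation H := (quaternion R).
Implicit Types X Y : H * H.

(** The vector matrix [[a, v; w, b]], with [a], [b] real and [v], [w] in [R^3], is
encoded as the pair of the quaternions [a + v] and [b + w], of which only the
vector space structure matters.  The product is
[[a a' - v . w', a v' + b' v + w x w'; a' w + b w' + v x v', b b' - w . v']]. *)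
Definition zorn_mul X Y : H * H :=
  let: (Quat a v1 v2 v3, Quat b w1 w2 w3) := X in
  let: (Quat a' v1' v2' v3', Quat b' w1' w2' w3') := Y in
  (Quat (a * a' - (v1 * w1' + v2 * w2' + v3 * w3'))
        (a * v1' + b' * v1 + (w2 * w3' - w3 * w2'))
        (a * v2' + b' * v2 + (w3 * w1' - w1 * w3'))
        (a * v3' + b' * v3 + (w1 * w2' - w2 * w1')),
   Quat (b * b' - (w1 * v1' + w2 * v2' + w3 * v3'))
        (a' * w1 + b * w1' + (v2 * v3' - v3 * v2'))
        (a' * w2 + b * w2' + (v3 * v1' - v1 * v3'))
        (a' * w3 + b * w3' + (v1 * v2' - v2 * v1'))).

Definition zorn_conj X : H * H :=
  (Quat (q_re X.2) (- q_i X.1) (- q_j X.1) (- q_k X.1),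
   Quat (q_re X.1) (- q_i X.2) (- q_j X.2) (- q_k X.2)).

(** The determinant of a vector matrix: its second term is [+ v . w] because the
dot products enter [zorn_mul] with a minus sign. *)
Definition zorn_norm X : R :=
  q_re X.1 * q_re X.2 + q_i X.1 * q_i X.2 + q_j X.1 * q_j X.2
  + q_k X.1 * q_k X.2.

Lemma zorn_mul_conj X :
  zorn_mul X (zorn_conj X) = (Quat (zorn_norm X) 0 0 0, Quat (zorn_norm X) 0 0 0).
Proof.
case: X => [[????] [????]]; rewrite /zorn_norm.
by congr (Quat _ _ _ _, Quat _ _ _ _) => /=; ring.
Qed.

(** The hypothesis says that [X] lies in the radical of the norm; in this form it
needs no name for the polar form. *)
Lemma zorn_norm_nondegenerate X :
  (forall Y, zorn_norm (X + Y) = zorn_norm Y) -> X = 0.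
Proof.
move=> normD.
have normX : zorn_norm X = 0.
  by rewrite -[X]addr0 normD /zorn_norm /=; ring.
have polar Y : zorn_norm (X + Y) - zorn_norm X - zorn_norm Y = 0.
  by rewrite normD normX subr0 subrr.
(* The polar form pairs each coordinate with that of a dual matrix unit. *)
case: X polar {normD normX} => [[a v1 v2 v3] [b w1 w2 w3]] polar.
congr (Quat _ _ _ _, Quat _ _ _ _).
- by rewrite -(polar (0, Quat 1 0 0 0)) /zorn_norm /=; ring.
- by rewrite -(polar (0, Quat 0 1 0 0)) /zorn_norm /=; ring.
- by rewrite -(polar (0, Quat 0 0 1 0)) /zorn_norm /=; ring.
- by rewrite -(polar (0, Quat 0 0 0 1)) /zorn_norm /=; ring.
- by rewrite -(polar (Quat 1 0 0 0, 0)) /zorn_norm /=; ring.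
- by rewrite -(polar (Quat 0 1 0 0, 0)) /zorn_norm /=; ring.
- by rewrite -(polar (Quat 0 0 1 0, 0)) /zorn_norm /=; ring.
- by rewrite -(polar (Quat 0 0 0 1, 0)) /zorn_norm /=; ring.
Qed.

Definition zorn_lin (p q e1 e2 e3 f1 f2 f3 : O') X : O' :=
  q_re X.1 *: p + q_i X.1 *: e1 + q_j X.1 *: e2 + q_k X.1 *: e3 +
  (q_re X.2 *: q + q_i X.2 *: f1 + q_j X.2 *: f2 + q_k X.2 *: f3).

Lemma zorn_lin_linear p q e1 e2 e3 f1 f2 f3 :
  linear (zorn_lin p q e1 e2 e3 f1 f2 f3).
Proof.
move=> r [[????] [????]] [[????] [????]].
by rewrite /zorn_lin; oct_coords; ring.
Qed.

Lemma zorn_lin_mul p q e1 e2 e3 f1 f2 f3 :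
  p ** p = p -> q ** q = q -> p ** q = 0 -> q ** p = 0 ->
  zorn_table p q e1 e2 e3 f1 f2 f3 -> zorn_table p q e2 e3 e1 f2 f3 f1 ->
  zorn_table p q e3 e1 e2 f3 f1 f2 ->
  let phi := zorn_lin p q e1 e2 e3 f1 f2 f3 in
  forall X Y, phi (zorn_mul X Y) = phi X ** phi Y.
Proof.
move=> pp qq pq qp t1 t2 t3 phi [[????] [????]] [[????] [????]].
rewrite /phi /zorn_lin.
rewrite !(oct_mulDl, oct_mulDr, oct_mulZl, oct_mulZr).
rewrite pp qq pq qp !t1 !t2 !t3.
by clear; oct_coords; ring.
Qed.

End ZornMap.

(** * The torsor of null triples *)

Section Torsor.
Variable R : realType.
Local Notation O' := (split_octonion R).
Local Notation H := (quaternion R).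
Implicit Types (X Y : H * H) (g : O' -> O') (t : O' * O' * O').

Definition zorn_map t : H * H -> O' :=
  let: (x, y, z) := t in
  zorn_lin (zorn_p x y z) (zorn_q x y z) x y z (y ** z) (z ** x) (x ** y).

Lemma zorn_map_linear t : linear (zorn_map t).
Proof. by case: t => [[x y] z]; apply: zorn_lin_linear. Qed.

Lemma zorn_map_generators t :
  (zorn_map t (Quat 0 1 0 0, 0), zorn_map t (Quat 0 0 1 0, 0),
   zorn_map t (Quat 0 0 0 1, 0)) = t.
Proof.
case: t => [[x y] z]; rewrite /zorn_map /zorn_lin.
cbv beta iota delta [fst snd q_re q_i q_j q_k].
by rewrite !scale0r !scale1r !(addr0, add0r).
Qed.

Lemma zorn_map_act g t X :
  G2' R g -> g (zorn_map t X) = zorn_map (act_triple g t) X.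
Proof.
case: t => [[x y] z] [/linear_morphisms[_ gN gD gZ] _ gM].
rewrite /zorn_map /zorn_lin /zorn_p /zorn_q /act_triple.
(* Simplification would also unfold the octonion operations. *)
cbv beta iota delta [fst snd].
by rewrite -!gM !(gD, gZ, gN).
Qed.

Lemma zorn_map_mul t X Y :
  null_triple t -> zorn_map t (zorn_mul X Y) = zorn_map t X ** zorn_map t Y.
Proof.
case: t => [[x y] z] /null_triple_generators gen.
have gen2 := zorn_generators_rot gen; have gen3 := zorn_generators_rot gen2.
have t1 := zorn_generators_table gen.
have t2 := zorn_generators_table gen2; have t3 := zorn_generators_table gen3.
rewrite (zorn_p_rot gen2) (zorn_q_rot gen2) in t3.
rewrite (zorn_p_rot gen) (zorn_q_rot gen) in t2 t3.
have [_ [xx _ _] _ _] := gen.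
have pq : zorn_p x y z ** zorn_q x y z = 0.
  rewrite /zorn_p /zorn_q oct_mulNl oct_mulNr opprK oct_moufang t1.
  by rewrite oct_mul0 oct_0mul.
have qp : zorn_q x y z ** zorn_p x y z = 0.
  rewrite /zorn_p /zorn_q oct_mulNl oct_mulNr opprK oct_moufang t1.
  by rewrite oct_mul0 oct_0mul.
have p1q := zorn_pq1 gen.
apply: zorn_lin_mul => //.
  by apply: oct_mul_compl_l qp; rewrite addrC.
by apply: oct_mul_compl_l pq.
Qed.

(** Conjugation exchanges [p] and [q] because it reverses products; it negates
[y z], [z x] and [x y] because the factors anticommute. *)
Lemma zorn_map_conj t X :
  null_triple t -> zorn_map t (zorn_conj X) = oct_conj (zorn_map t X).
Proof.
case: t => [[x y] z] /null_triple_generators.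
move=> [[xI yI zI] _ [yx zy xz] _].
have [_ _ conjD conjZ] := linear_morphisms (@oct_conj_linear R).
rewrite /zorn_map /zorn_lin !(conjD, conjZ).
rewrite /zorn_p /zorn_q !oct_conjN !oct_conjM xI yI zI.
rewrite !(oct_mulNl, oct_mulNr) ?opprK.
rewrite zy xz yx !(oct_mulNl, oct_mulNr) ?opprK.
case: X => [[????] [????]] /=.
by clear; oct_coords; ring.
Qed.

(** Both norms are products of an element with its conjugate. *)
Lemma zorn_map_norm t X : null_triple t -> oct_Q (zorn_map t X) = zorn_norm X.
Proof.
move=> tN; apply: oct_one_scale_inj.
rewrite -oct_mul_conj -zorn_map_conj // -zorn_map_mul // zorn_mul_conj.
case: t tN => [[x y] z] /null_triple_generators gen.
rewrite -(zorn_pq1 gen) scalerDr /zorn_map /zorn_lin.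
by rewrite !scale0r !addr0.
Qed.

(** A vector in the kernel would lie in the radical of the norm. *)
Lemma zorn_map_bij t : null_triple t -> bijective (zorn_map t).
Proof.
move=> tN; have lin := zorn_map_linear t.
have [_ phiN phiD _] := linear_morphisms lin.
apply: linear_inj_bij lin _ => X X' phiXX'; apply/subr0_eq.
apply: zorn_norm_nondegenerate => Y.
by rewrite -!(zorn_map_norm _ tN) !phiD phiN phiXX' subrr add0r.
Qed.

(** The vectors [(v, v)] with [v] imaginary form a totally isotropic 3-space in
[I]; on [(i, i), (j, j), (k, k)] the triple product [(x x y) . z] is [4], hence
the factor [1/8]. *)
Lemma null_triple_exists : exists t, @null_triple R t.
Proof.
exists ((Quat 0 8^-1 0 0, Quat 0 8^-1 0 0), (Quat 0 0 1 0, Quat 0 0 1 0),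
        (Quat 0 0 0 1, Quat 0 0 0 1)).
split.
- by split; apply/imag_octonionP.
- have e8 : (8^-1 : R) <> 0 by apply/eqP; rewrite invr_eq0 pnatr_eq0.
  have e1 : (1 : R) <> 0 by apply/eqP; rewrite oner_eq0.
  by split=> -[].
- by split; rewrite /null_vector oct_dotxx /oct_Q subrr.
- by split; rewrite /oct_dot /oct_Q /quat_normsq /=; ring.
- by rewrite /oct_dot /oct_cross /oct_Q /quat_normsq /=; field.
Qed.
End Torsor.

(* The set of null triples is a torsor: it is nonempty, stable under the action
   of G2', and this action is free and transitive on it. *)
Theorem theorem13 (R : realType) :
  [/\ exists t, @null_triple R t,
      forall g t, G2' R g -> null_triple t -> null_triple (act_triple g t)
    & forall t t' : split_octonion R * split_octonion R * split_octonion R,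
        null_triple t -> null_triple t' ->
        exists! g : split_octonion R -> split_octonion R,
          G2' R g /\ act_triple g t = t'].
Proof.
split; [exact: null_triple_exists | exact: null_triple_act |].
move=> t t' tN t'N.
have [F FK KF] := zorn_map_bij tN.
have [F' F'K KF'] := zorn_map_bij t'N.
exists (zorn_map t' \o F); split; first split; first split.
- move=> r u v; rewrite -{1}[u]KF -{1}[v]KF -zorn_map_linear /= FK.
  exact: zorn_map_linear.
- by exists (zorn_map t \o F') => u /=; rewrite ?F'K ?KF ?FK ?KF'.
- move=> u v; rewrite -{1}[u]KF -{1}[v]KF -zorn_map_mul //= FK.
  exact: zorn_map_mul.
- by rewrite -{1}(zorn_map_generators t) /act_triple /= !FK zorn_map_generators.
move=> h [hG ht]; apply/funext => u /=.
by rewrite -{2}[u]KF zorn_map_act // ht.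
Qed.
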